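(* For every $\epsilon>0$ there is a constant $C_\epsilon>0$ depending only on $\epsilon$ such that the following holds. Let $Q\ge 1$, $M$, $N$ be integers with $N>0$, let $\alpha,\beta,\gamma\in\mathbb{R}$ with $\alpha>0$, put $f(x)=\alpha x^2+\beta x+\gamma$, and suppose that $a,b\in\mathbb{Z}$ with $b>0$ and $\gcd(a,b)=1$ satisfy $$\left|\frac{\beta}{\alpha}-\frac{a}{b}\right|<\frac{1}{4bN}.$$ Let $$F(Q)=\{p/q\in\mathbb{Q} : 1\le q\le Q,\ 0\le p<q,\ \gcd(p,q)=1\}.$$ Then for every sequence of complex numbers $(a_n)_{M+1\le n\le M+N}$, $$\sum_{x\in F(Q)}\left|\sum_{n=M+1}^{M+N} a_n\, e\left(x f(n)\right)\right|^2 \le C_\epsilon \left(Q^2+Q\sqrt{\alpha N\left(|M|+N+a/b\right)+1}\right)\Pi\, Z,$$ where $$\Pi=\left(\frac{b}{\alpha}+1\right)^{\frac12+\epsilon}\left[Nb(|M|+N)+|a|+\frac{b}{\alpha}\right]^{\epsilon}\quad\text{and}\quad Z=\sum_{n=M+1}^{M+N}|a_n|^2 .$$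
   Context: Notation: $e(t)=\exp(2\pi i t)$ for real $t$.
   Formalization: Under the square root, $a/b$ is replaced by $|a|/b$: the printed bound fails for some $a<0$ (e.g. $Q=1$, $M=0$, $\alpha=b=1$, $\beta=a=-N$, $\gamma=0$, $a_n=1$, $\epsilon<1/2$); for $a\ge 0$ the two agree. *)

(* Defs.v *)
From HB Require Import structures.
From mathcomp Require Import all_boot all_order all_algebra.
From mathcomp Require Import all_classical all_reals all_analysis.
From mathcomp Require Export complex.

Set Implicit Arguments.
Unset Strict Implicit.
Unset Printing Implicit Defensive.

Import Order.TTheory GRing.Theory Num.Theory.

Local Open Scope classical_set_scope.
Local Open Scope ring_scope.
Local Open Scope complex_scope.

(* exp(2 pi i t), written with Euler's formula. *)
Definition e (R : realType) (t : R) : R[i] :=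
  cos (2 * pi * t) +i* sin (2 * pi * t).

Definition cabs (R : realType) (z : R[i]) : R := ComplexField.Normc.normc z.

(* A set of rationals, so each fraction counts once.  It is finite by
   [finite_farey]; hence [\sum_(x \in farey Q)] is a genuine sum (the library gives
   the value 0 to a sum with infinite support). *)
Definition farey (Q : nat) : set rat :=
  [set x | exists p q : nat,
     [/\ (1 <= q <= Q)%N, (p < q)%N, coprime p q & x = p%:R / q%:R]].

Lemma finite_farey (Q : nat) : finite_set (farey Q).
Proof.
apply: (@sub_finite_set _ _
  [set` [seq (p%:R / q%:R : rat) | p <- iota 0 Q.+1, q <- iota 0 Q.+1]]);
  last exact: finite_seq.
move=> x [p [q [/andP[_ qQ] pq _ ->]]]; rewrite /mkset.
apply: (allpairs_f (fun p q : nat => p%:R / q%:R : rat)); rewrite mem_iota add0n ltnS //.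
exact: leq_trans (ltnW pq) qQ.
Qed.

Definition quadratic (R : realType) (alpha beta gamma x : R) : R :=
  alpha * x ^+ 2 + beta * x + gamma.

(* In sums over M < n <= M + N the index is n = M + k with 1 <= k <= N. *)
Definition amplitude_sum (R : realType) (M : int) (N : nat) (f : R -> R)
    (c : int -> R[i]) (x : R) : R[i] :=
  \sum_(1 <= k < N.+1) c (M + k%:Z) * e (x * f (M + k%:Z)%:~R).

Definition Zsum (R : realType) (M : int) (N : nat) (c : int -> R[i]) : R :=
  \sum_(1 <= k < N.+1) cabs (c (M + k%:Z)) ^+ 2.

Definition PiFactor (R : realType) (eps alpha : R) (M : int) (N : nat)
    (a b : int) : R :=
  (b%:~R / alpha + 1) `^ (1 / 2 + eps) *
  (N%:R * b%:~R * (`|M%:~R| + N%:R) + `|a%:~R| + b%:~R / alpha) `^ eps.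

(* The square root contains |a| / b.  With a / b the radicand can be negative,
   and the large sieve bound fails even where it is positive: for alpha = 1,
   beta = a = - N, b = 1, gamma = M = 0, Q = 1 and all coefficients 1 the
   radicand is 1, the left side of the inequality is N ^ 2 and the right side
   is O(N ^ (1 + 2 * eps)), a contradiction when eps < 1 / 2.  The two forms
   agree when a >= 0. *)
Definition sieve_factor (R : realType) (Q : nat) (alpha : R) (M : int)
    (N : nat) (a b : int) : R :=
  Q%:R ^+ 2 +
  Q%:R * Num.sqrt (alpha * N%:R *
                     (`|M%:~R| + N%:R + `|a%:~R| / b%:~R) + 1).

(* Main.v *)
Require Import Defs.
From mathcomp Require Import all_boot all_order all_algebra.
From mathcomp Require Import all_classical all_reals all_analysis.
From mathcomp Require Import ring lra zify.
Import Order.TTheory GRing.Theory Num.Theory.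
Local Open Scope classical_set_scope.
Local Open Scope ring_scope.
Local Open Scope complex_scope.

(** Let [S x] be the inner sum, [Z] the sum of the [|a_n|^2] and
    [Y = alpha N (|M| + N + |a| / b)].  There are at most [Q^2] Farey fractions,
    so Cauchy-Schwarz bounds the square of [sum_x |S x|^2] by
    [Q^2 sum_x |S x|^4].  It is enough to bound the fourth moment by a constant
    times [(Q^2 + Y + 1) A Z^2], where [A] is [b / alpha + 1] up to the factor
    with exponent [2 eps]; the square root then produces both the shape
    [Q^2 + Q sqrt (Y + 1)] and the exponent [1/2] of [b / alpha + 1].

    The gain of the fourth moment is that [|S x|^2] is again an exponential sum
    in [x], over pairs [(n, m)], with coefficients [a_n conj(a_m)] and
    frequencies [f n - f m], and these frequencies are arithmetic: by the
    hypothesis on [beta / alpha], [f n - f m] is [alpha / b] times the integer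
    [(n - m) (b (n + m) + a)] up to an error of at most [1/4] in that integer
    ([phase_diffE], [phase_error]).  The pairs where the integer vanishes
    contribute at most [2 Z] for every [x] ([degenerate_sum_le]).  A nonzero
    integer [t] comes from few pairs, because [n - m] divides [t] and determines
    the pair ([count_pair_key_eq], [divisor_bound]); hence an interval of length
    [1/32] contains at most about [A] frequencies ([count_phase_le]).  The
    fourth moment is thus a mean square over Farey fractions of an exponential
    sum with real frequencies in an interval of length [6 Y], at most about [A] of
    them in each cell of length [1/32], and [large_sieve] applies ([fourth_moment_le]).

    The large sieve is obtained from Parseval on a cyclic group.  If the points
    and the frequencies all lie on suitable grids, [e (x y)] becomes
    [e (k l / m)] and the bound is the orthogonality of the characters modulo
    [m] ([fourier_bessel]).  Moving each sample point within its grid cell costs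
    only a factor 4 as soon as the frequencies are at most [1/32]
    ([mean_square_perturb]), and duality exchanges points and frequencies
    ([mean_square_dual]), so that both can be moved off their grids. *)

Set Implicit Arguments.
Unset Strict Implicit.
Unset Printing Implicit Defensive.

(** * Squared modulus and the additive character *)

(** The square of [cabs], in a form without square root: it is polynomial in the
    coordinates, which is what the algebra below needs. *)
Definition sqnorm (R : realType) (z : R[i]) : R :=
  complex.Re z ^+ 2 + complex.Im z ^+ 2.

Section SquaredNorm.
Variable R : realType.
Implicit Types (z w : R[i]) (s t : R).

Lemma sqr_cabs z : cabs z ^+ 2 = sqnorm z.
Proof.
case: z => a b; rewrite /cabs /sqnorm /= sqr_sqrtr //.
by rewrite addr_ge0 ?sqr_ge0.
Qed.

Lemma sqnorm_ge0 z : 0 <= sqnorm z.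
Proof. by rewrite addr_ge0 ?sqr_ge0. Qed.

Lemma sqnormE z : (sqnorm z)%:C = z * conjc z.
Proof.
case: z => a b; apply/eqP; rewrite eq_complex /sqnorm /=.
by apply/andP; split; apply/eqP; ring.
Qed.

Lemma conjM z w : conjc (z * w) = conjc z * conjc w.
Proof. exact: rmorphM. Qed.

Lemma sqnormM z w : sqnorm (z * w) = sqnorm z * sqnorm w.
Proof. by case: z w => [a b] [c d]; rewrite /sqnorm /=; ring. Qed.

Lemma sqnormJ z : sqnorm (conjc z) = sqnorm z.
Proof. by case: z => a b; rewrite /sqnorm /=; ring. Qed.

Lemma sqnormD_le z w : sqnorm (z + w) <= 2 * sqnorm z + 2 * sqnorm w.
Proof.
case: z w => [a b] [c d]; rewrite /sqnorm /= -subr_ge0.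
have -> : 2 * (a ^+ 2 + b ^+ 2) + 2 * (c ^+ 2 + d ^+ 2)
   - ((a + c) ^+ 2 + (b + d) ^+ 2) = (a - c) ^+ 2 + (b - d) ^+ 2 by ring.
by rewrite addr_ge0 ?sqr_ge0.
Qed.

Lemma eD s t : e (s + t) = e s * e t.
Proof. by rewrite /e mulrDr cosD sinD; apply/eqP; rewrite eq_complex /= eqxx /= addrC. Qed.

Lemma e0 : e (0 : R) = 1.
Proof. by rewrite /e mulr0 cos0 sin0. Qed.

Lemma conj_e t : conjc (e t) = e (- t).
Proof. by rewrite /e /= mulrN cosN sinN. Qed.

Lemma sqnorm_e t : sqnorm (e t) = 1.
Proof. by rewrite /sqnorm /= cos2Dsin2. Qed.

Lemma e_natM n t : e (n%:R * t) = e t ^+ n.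
Proof.
elim: n => [|n IH]; first by rewrite mul0r e0.
by rewrite exprS -IH -eD -natr1 mulrDl mul1r addrC.
Qed.

Lemma e_nat n : e (n%:R : R) = 1.
Proof.
rewrite -[n%:R]mulr1 e_natM; suff -> : e (1 : R) = 1 by rewrite expr1n.
by rewrite /e mulr1 mulr_natl cos2pi sin2pi.
Qed.

Lemma e_neq1 t : 0 < t < 1 -> e t != 1.
Proof.
move=> /andP[t0 t1]; apply/eqP => /(congr1 (@complex.Re R)) /=.
rewrite -mulrA mulr_natl cos_mulr2n => /eqP.
have := cos2Dsin2 (pi * t); set c := cos _; set s := sin _ => cs.
have : 0 < s.
  by apply: sin_gt0_pi; rewrite mulr_gt0 ?pi_gt0 //= gtr_pMr ?pi_gt0.
by move=> s0 /eqP h; nra.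
Qed.

End SquaredNorm.

(** * Exponential sums: orthogonality and derivatives *)

(** Frequencies [theta] and sample point [y] enter symmetrically, so that the
    dual of such a sum is again of this form. *)
Definition expsum (R : realType) (I : Type) (r : seq I) (theta : I -> R)
    (c : I -> R[i]) (y : R) : R[i] :=
  \sum_(i <- r) c i * e (theta i * y).

Section Sums.
Variable R : realType.

Lemma sqnorm_sumE (I : Type) (r : seq I) (z : I -> R[i]) :
  (sqnorm (\sum_(i <- r) z i))%:C = \sum_(i <- r) \sum_(j <- r) z i * conjc (z j).
Proof. by rewrite sqnormE rmorph_sum big_distrlr. Qed.

Lemma sum_e_eq0 (m : nat) (t : int) : (0 < `|t| < m)%N ->
  \sum_(l < m) e (l%:R * (t%:~R / m%:R) : R) = 0.
Proof.
move=> /andP[t0 tm]; have m0 : (0 < m)%N by exact: leq_ltn_trans tm.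
have mR : 0 < m%:R :> R by rewrite ltr0n.
pose z := e (t%:~R / m%:R : R).
have z1 : z != 1.
  have small (u : nat) : (0 < u < m)%N -> e (u%:R / m%:R : R) != 1.
    by move=> /andP[u0 um]; rewrite e_neq1// divr_gt0 ?ltr0n//= ltr_pdivrMr// mul1r ltr_nat.
  rewrite /z; case: (intP t) t0 tm => [//|u|u]; rewrite ?abszN absz_nat => u0 um.
    by apply: small.
  rewrite mulrNz mulNr -conj_e; apply/eqP => /(congr1 conjc); rewrite conjcK conjc1.
  by apply/eqP/small.
have zm : z ^+ m = 1.
  rewrite -e_natM mulrC divfK ?gt_eqF//.
  case: (intP t) => [|u|u]; rewrite ?e0 ?mulrNz ?e_nat -?conj_e ?e_nat ?conjc1//.
apply/eqP; rewrite -(mulrI_eq0 _ (mulfI (_ : z - 1 != 0))) ?subr_eq0//.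
under eq_bigr do rewrite e_natM.
by rewrite -subrX1 zm subrr.
Qed.

(** Parseval for the characters modulo [m]: the frequencies [k / m] with [k < K]
    are distinct modulo 1 because [K <= m]. *)
Lemma fourier_bessel (m K : nat) (b : 'I_K -> R[i]) : (K <= m)%N ->
  \sum_(l < m) sqnorm (\sum_(k < K) b k * e (k%:R / m%:R * l%:R)) =
  m%:R * \sum_(k < K) sqnorm (b k).
Proof.
move=> Km; apply: complexI; rewrite rmorphM rmorph_sum rmorph_nat rmorph_sum /=.
under eq_bigr do rewrite sqnorm_sumE.
rewrite exchange_big /= mulr_sumr; apply: eq_bigr => k _.
rewrite exchange_big /= (bigD1 k)//= [X in _ + X]big1 ?addr0 => [|k' k'k].
  rewrite (eq_bigr (fun=> (sqnorm (b k))%:C)) => [|l _].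
    by rewrite sumr_const card_ord mulr_natl.
  by rewrite conjM conj_e mulrACA -eD subrr e0 mulr1 sqnormE.
rewrite (eq_bigr (fun l : 'I_m => b k * conjc (b k') *
     e (l%:R * (((k : int) - (k' : int))%:~R / m%:R)))) => [|l _]; last first.
  rewrite conjM conj_e mulrACA -eD; congr (_ * e _).
  by rewrite rmorphB /=; ring.
rewrite -mulr_sumr sum_e_eq0 ?mulr0//; apply/andP; split.
  by rewrite absz_gt0 subr_eq0 eqz_nat eq_sym.
have := ltn_ord k; have := ltn_ord k'; lia.
Qed.
End Sums.

Section Perturbation.
Variables (R : realType).

Lemma is_derive_Re_expsum (I : Type) (r : seq I) (theta : I -> R) (c : I -> R[i]) (y : R) :
  is_derive y 1 (fun y => complex.Re (expsum r theta c y))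
    (complex.Re (expsum r theta (fun i => c i * (0 +i* (2 * pi * theta i))) y)).
Proof.
rewrite /expsum; elim: r => [|i r IH].
  under eq_fun do rewrite big_nil; rewrite big_nil; exact: is_derive_cst.
under eq_fun do rewrite big_cons raddfD; rewrite big_cons raddfD /=.
apply: is_deriveD => //.
have sc : is_derive y 1 (fun y => 2 * pi * (theta i * y)) (2 * pi * theta i).
  have -> : (fun y => 2 * pi * (theta i * y)) = (2 * pi * theta i) \*: (id : R -> R).
    by apply/funext => t /=; rewrite mulrA.
  by apply: is_derive_eq; rewrite scaler1.
case: (c i) => p q /=.
apply: (@is_derive_eq _ _ _ (p \*: (cos \o (fun y => 2 * pi * (theta i * y)))
  - q \*: (sin \o (fun y => 2 * pi * (theta i * y))))).
by rewrite /GRing.scale /=; ring.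
Qed.

(** The mean value theorem needs a real function, hence the separate treatment of
    real and imaginary parts, with different intermediate points.  The derivative
    is again an exponential sum, with coefficients multiplied by
    [2 pi i theta]. *)
Lemma Re_expsum_MVT (I : Type) (r : seq I) (theta : I -> R) (c : I -> R[i]) (p s : R) :
  0 <= s <= 1 -> exists u, 0 <= u <= 1 /\
  complex.Re (expsum r theta c (p + s)) = complex.Re (expsum r theta c p) +
    s * complex.Re (expsum r theta (fun i => c i * (0 +i* (2 * pi * theta i))) (p + u)).
Proof.
move=> /andP[s0 s1].
pose f y := complex.Re (expsum r theta c y).
pose df y := complex.Re (expsum r theta (fun i => c i * (0 +i* (2 * pi * theta i))) y).
have fd (x : R) : is_derive x 1 f (df x) by exact: is_derive_Re_expsum.
have [||x] := @MVT_segment R f df p (p + s) _ (fun x (_ : x \in _) => fd x).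
- by rewrite lerDl.
- apply: derivable_within_continuous => x _; exact: ex_derive.
rewrite in_itv /= => /andP[px xs] E; exists (x - p); split.
  apply/andP; split; lra.
rewrite [p + (x - p)]addrC subrK -/(f p) -/(f (p + s)) -/(df x).
have {}E : f (p + s) = f p + df x * (p + s - p) by rewrite -E; ring.
by rewrite E; ring.
Qed.
End Perturbation.

(** * Stability under perturbation and duality *)

(** Cauchy-Schwarz against the constant 1. *)
Lemma sqr_sum_le (R : realType) (I : Type) (r : seq I) (x : I -> R) :
  (\sum_(i <- r) x i) ^+ 2 <= (size r)%:R * \sum_(i <- r) x i ^+ 2.
Proof.
elim: r => [|i r IH]; first by rewrite !big_nil expr0n mul0r.
rewrite !big_cons /= -natr1.
set S := \sum_(j <- r) x j in IH *; set T := \sum_(j <- r) _ in IH *.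
set n : R := (size r)%:R in IH *; have : 0 <= n by rewrite ler0n.
rewrite le_eqVlt => /predU1P[n0|n_gt0].
  have S0 : S = 0 by apply/eqP; rewrite -sqrf_eq0 eq_le sqr_ge0 (le_trans IH)// -n0 mul0r.
  by rewrite S0 -n0; have : 0 <= T by [apply: sumr_ge0 => j _; exact: sqr_ge0]; nra.
suff : 0 <= n * (x i ^+ 2) + T - 2 * x i * S by nra.
rewrite -(pmulr_rge0 _ n_gt0).
have := sqr_ge0 (n * x i - S); nra.
Qed.

Lemma sqnorm_sum_le (R : realType) (I : Type) (r : seq I) (z : I -> R[i]) :
  sqnorm (\sum_(i <- r) z i) <= (size r)%:R * \sum_(i <- r) sqnorm (z i).
Proof.
rewrite /sqnorm !raddf_sum big_split mulrDr.
by rewrite lerD//; exact: sqr_sum_le.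
Qed.

(** The squared operator norm of the matrix [e (theta i * y j)] is at most [D]. *)
Definition mean_square_le (R : realType) (I J : Type) (rI : seq I) (rJ : seq J)
    (theta : I -> R) (y : J -> R) (D : R) : Prop :=
  forall c : I -> R[i],
  \sum_(j <- rJ) sqnorm (expsum rI theta c (y j)) <= D * \sum_(i <- rI) sqnorm (c i).

Section Stability.
Variables (R : realType) (I J : eqType) (rI : seq I) (rJ : seq J).
Variables (theta : I -> R) (p : J -> R).
Hypothesis theta_small : {in rI, forall i, `|theta i| <= 1 / 32}.

Let dcoef (c : I -> R[i]) i := c i * (0 +i* (2 * pi * theta i)).

Lemma Im_expsum_MVT (c : I -> R[i]) (q s : R) :
  0 <= s <= 1 -> exists u, 0 <= u <= 1 /\
  complex.Im (expsum rI theta c (q + s)) = complex.Im (expsum rI theta c q) +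
    s * complex.Im (expsum rI theta (dcoef c) (q + u)).
Proof.
have rot d y : complex.Im (expsum rI theta d y) =
    complex.Re (expsum rI theta (fun i => (0 +i* (-1)) * d i) y).
  rewrite /expsum; under [in RHS]eq_bigr do rewrite -mulrA.
  by rewrite -mulr_sumr; case: (\sum_(i <- _) _) => a b /=; ring.
move=> /(Re_expsum_MVT rI theta (fun i => (0 +i* (-1)) * c i) q)[u [u01 E]].
exists u; split => //; rewrite !rot E; congr (_ + _ * complex.Re _).
by apply: eq_bigr => i _; rewrite /dcoef !mulrA.
Qed.

(** By the mean value theorem, moving the sample points changes the sum by a
    derivative sum, which is an exponential sum at other admissible points whose
    coefficients are smaller by the factor [2 pi / 32 < 1 / 4].  So a bound [D]
    valid for all displacements improves itself to [2 D0 + D / 4]. *)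
Lemma mean_square_perturb_step (D0 D : R) : 0 <= D ->
  mean_square_le rI rJ theta p D0 ->
  (forall s, (forall j, 0 <= s j <= 1) -> mean_square_le rI rJ theta (fun j => p j + s j) D) ->
  forall s, (forall j, 0 <= s j <= 1) ->
    mean_square_le rI rJ theta (fun j => p j + s j) (2 * D0 + D / 4).
Proof.
move=> D_ge0 HD0 HD s s01 c.
have [u /all_and2[u01 uE]] := choice (fun j => Re_expsum_MVT rI theta c (p j) (s01 j)).
have [v /all_and2[v01 vE]] := choice (fun j => Im_expsum_MVT c (p j) (s01 j)).
pose G w := \sum_(j <- rJ) sqnorm (expsum rI theta (dcoef c) (p j + w j)).
(* The square of 2 pi / 32, from pi < 4. *)
have dc i : i \in rI -> sqnorm (dcoef c i) <= 16^-1 * sqnorm (c i).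
  move=> i_rI; rewrite sqnormM mulrC ler_wpM2r ?sqnorm_ge0// /sqnorm /= expr0n add0r.
  have := theta_small i_rI; rewrite ler_norml => /andP[h1 h2].
  have := pihalf_lt2 R; have := pi_gt0 R => pi0 pi4.
  rewrite exprMn; have : (2 * pi) ^+ 2 <= (64 : R) by nra.
  have : theta i ^+ 2 <= (1 / 32) ^+ 2 by nra.
  have := sqr_ge0 (theta i); have := sqr_ge0 (2 * pi : R); nra.
have HG w : (forall j, 0 <= w j <= 1) -> G w <= D / 16 * \sum_(i <- rI) sqnorm (c i).
  move=> /HD /(_ (dcoef c)) /le_trans; apply; rewrite -mulrA ler_wpM2l// mulr_sumr.
  by rewrite big_seq [leRHS]big_seq; apply: ler_sum => i; exact: dc.
apply: (@le_trans _ _ (2 * (\sum_(j <- rJ) sqnorm (expsum rI theta c (p j))) +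
   2 * G u + 2 * G v)); last first.
  by have := HG _ u01; have := HG _ v01; have := HD0 c; lra.
rewrite /G !mulr_sumr -!big_split /=; apply: ler_sum => j _.
move: (uE j) (vE j) (s01 j); rewrite /sqnorm -/(dcoef c).
set A := complex.Re _; set B := complex.Re _; set A' := complex.Re _ => ->.
set A'' := complex.Im _; set B' := complex.Im _; set B'' := complex.Im _ => ->.
move=> /andP[s0 s1].
have sq (x y : R) : (x + s j * y) ^+ 2 <= 2 * x ^+ 2 + 2 * y ^+ 2.
  have h : (s j * y) ^+ 2 <= y ^+ 2.
    by rewrite exprMn ler_piMl ?sqr_ge0// expr_le1.
  have := sqr_ge0 (x - s j * y); nra.
have := sq B A'; have := sq B' B''; have := sqr_ge0 (complex.Im (expsum rI theta (dcoef c) (p j + u j))).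
have := sqr_ge0 (complex.Re (expsum rI theta (dcoef c) (p j + v j))); lra.
Qed.

(** Iterating the self-improvement from any bound, here the trivial one [B],
    approaches the fixed point of [D = 2 D0 + D / 4], which is at most
    [4 D0]. *)
Lemma mean_square_perturb (D0 : R) : 0 <= D0 ->
  mean_square_le rI rJ theta p D0 ->
  forall y, {in rJ, forall j, p j <= y j <= p j + 1} ->
    mean_square_le rI rJ theta y (4 * D0).
Proof.
move=> D0_ge0 HD0 y py.
(* The induction quantifies over displacements in [0, 1] at every index, hence the
   value 0 outside rJ. *)
pose s j := if j \in rJ then y j - p j else 0.
suff H : mean_square_le rI rJ theta (fun j => p j + s j) (4 * D0).
  move=> c; apply: le_trans (H c); rewrite le_eqVlt; apply/predU1P; left.
  by apply: eq_big_seq => j j_rJ; rewrite /s j_rJ addrC subrK.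
have s01 j : 0 <= s j <= 1.
  rewrite /s; case: ifP => [/py /andP[h1 h2]|_]; last by rewrite lexx ler01.
  by rewrite subr_ge0 h1 lerBlDl.
pose B : R := (size rJ)%:R * (size rI)%:R.
have B0 : 0 <= B by rewrite mulr_ge0 ?ler0n.
have iter L t : (forall j, 0 <= t j <= 1) ->
    mean_square_le rI rJ theta (fun j => p j + t j) (4 * D0 + B / 4 ^+ L).
  elim: L t => [|L IH] t t01.
    move=> c; rewrite expr0 divr1; set S := \sum_(i <- rI) _.
    have S0 : 0 <= S by apply: sumr_ge0 => i _; exact: sqnorm_ge0.
    apply: (@le_trans _ _ (B * S)); last by rewrite ler_wpM2r// lerDr mulr_ge0.
    rewrite /B -mulrA mulr_natl -[_ *+ size rJ]addr0 -iter_addr -(count_predT rJ) -big_const_seq.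
    apply: ler_sum => j _; apply: le_trans (sqnorm_sum_le _ _) _.
    rewrite ler_wpM2l//; apply: ler_sum => i _.
    by rewrite sqnormM sqnorm_e mulr1.
  have Dge : 0 <= 4 * D0 + B / 4 ^+ L by rewrite addr_ge0 ?mulr_ge0 ?invr_ge0 ?exprn_ge0.
  move=> c; apply: le_trans (mean_square_perturb_step Dge HD0 IH t01 c) _.
  rewrite ler_wpM2r ?sumr_ge0// => [i _|]; first exact: sqnorm_ge0.
  by rewrite exprS invfM; lra.
move=> c; rewrite leNgt; apply/negP; rewrite -subr_gt0.
set S := \sum_(i <- rI) _; set T := \sum_(j <- rJ) _ => d0.
have S0 : 0 <= S by apply: sumr_ge0 => i _; exact: sqnorm_ge0.
set d := T - _ in d0; pose L := (Num.truncn (B * S / d)).+1.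
have : B * S / d < 4 ^+ L.
  rewrite (lt_trans (truncnS_gt _))// -natrX ltr_nat; exact: ltn_expl.
rewrite ltr_pdivrMr// => h.
have := iter L s s01 c; rewrite -/S -/T mulrDl => h'.
have : B / 4 ^+ L * S < d.
  by rewrite -mulrA [_^-1 * S]mulrC mulrA ltr_pdivrMr ?exprn_gt0// [d * _]mulrC.
rewrite /d; lra.
Qed.

End Stability.

(** A matrix and its transpose have the same norm.  The dual sum [T] equals the
    real part of a pairing of [b] with [g], where [g] is the original sum with the
    conjugate dual values as coefficients; the weighted inequality
    [2 Re (b g) <= D |b|^2 + |g|^2 / D] gives [T <= (D Z + T) / 2], that is
    [T <= D Z]. *)
Lemma mean_square_dual (R : realType) (I J : Type) (rI : seq I) (rJ : seq J)
    (theta : I -> R) (y : J -> R) (D : R) : 0 < D ->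
  mean_square_le rI rJ theta y D -> mean_square_le rJ rI y theta D.
Proof.
move=> D0 HD b; set Z := \sum_(i <- rJ) _.
pose S i := expsum rJ y b (theta i); pose T := \sum_(i <- rI) sqnorm (S i).
pose g j := expsum rI theta (fun i => conjc (S i)) (y j).
have TE : T = \sum_(j <- rJ) complex.Re (b j * g j).
  rewrite -raddf_sum /= -[LHS]/(complex.Re T%:C); congr complex.Re.
  rewrite rmorph_sum /=.
  under eq_bigr do rewrite sqnormE mulrC mulr_sumr.
  rewrite exchange_big /=; apply: eq_bigr => j _; rewrite mulr_sumr.
  by apply: eq_bigr => i _; rewrite [y j * _]mulrC mulrCA.
suff : T <= D / 2 * Z + T / 2 by rewrite -/T; lra.
have : \sum_(j <- rJ) sqnorm (g j) <= D * T.
  apply: le_trans (HD _) _; rewrite ler_wpM2l ?(ltW D0)//.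
  by under eq_bigr do rewrite sqnormJ.
move=> hg; apply: (@le_trans _ _ (D / 2 * Z + (2 * D)^-1 * \sum_(j <- rJ) sqnorm (g j))).
  rewrite {1}TE !mulr_sumr -big_split; apply: ler_sum => j _ /=.
  case: (b j) (g j) => [p q] [u v]; rewrite /sqnorm /=.
  rewrite -(ler_pM2l D0) [leRHS](_ : _ =
    (D ^+ 2 * (p ^+ 2 + q ^+ 2) + (u ^+ 2 + v ^+ 2)) / 2); last first.
    by field; rewrite gt_eqF.
  have := sqr_ge0 (D * p - u); have := sqr_ge0 (D * q + v); nra.
rewrite lerD2l invfM -mulrA mulrC ler_pM2r ?invr_gt0//.
by rewrite ler_pdivrMl.
Qed.

(** * The large sieve for real frequencies *)

Lemma sum_fibers_le (R : realType) (J : Type) (r : seq J) (g : J -> nat) (K : nat) (A : R)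
    (F : nat -> R) :
  (forall k, 0 <= F k) -> all (fun j => (g j < K)%N) r ->
  (forall k, (count (fun j => g j == k) r)%:R <= A) ->
  \sum_(j <- r) F (g j) <= A * \sum_(k < K) F k.
Proof.
move=> F0 gK cA.
have -> : \sum_(j <- r) F (g j) = \sum_(j <- r) \sum_(k < K) (g j == k)%:R * F k.
  elim: r gK {cA} => [|j r IH] /=; first by rewrite !big_nil.
  move=> /andP[jK /IH rK]; rewrite !big_cons rK; congr (_ + _).
  rewrite (bigD1 (Ordinal jK))//= eqxx mul1r big1 ?addr0// => k kj.
  by case: eqP => [gk|_]; rewrite ?mul0r//; case/eqP: kj; apply: val_inj.
rewrite exchange_big mulr_sumr /=; apply: ler_sum => k _.
rewrite -mulr_suml ler_wpM2r//; apply: le_trans (cA k).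
by rewrite -natr_sum ler_nat -sum1_count [leqRHS]big_mkcond leq_sum// => j _; case: eqP.
Qed.

Section Sieve.
Variables (R : realType) (xs : seq R) (P : nat).
Hypotheses (xs_uniq : uniq xs) (xs01 : {in xs, forall x : R, 0 <= x < 1}).
Hypothesis xs_spaced : {in xs &, forall x x' : R, x != x' -> P%:R^-1 <= `|x - x'|}.

(** Points at mutual distance at least [1 / P] fall into different cells of any
    grid of mesh [1 / W] with [W >= P]. *)
Lemma truncn_spaced_inj (W : nat) : (0 < P <= W)%N ->
  {in xs &, injective (fun x => Num.truncn (x * W%:R))}.
Proof.
move=> /andP[P0 PW] x x' xin x'in /= E; apply/eqP; case: eqVneq => // /(xs_spaced xin x'in).
have W0 : 0 < W%:R :> R by rewrite ltr0n (leq_trans P0).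
have bnd z : z \in xs -> (Num.truncn (z * W%:R))%:R <= z * W%:R < (Num.truncn (z * W%:R)).+1%:R.
  by move=> /xs01/andP[z0 _]; rewrite truncn_itv// mulr_ge0// ltW.
have := bnd _ xin; have := bnd _ x'in; rewrite E -natr1.
move=> /andP[a1 a2] /andP[b1 b2]; rewrite leNgt => /negP []; rewrite ltr_norml.
have PWV : W%:R^-1 <= P%:R^-1 :> R by rewrite lef_pV2 ?posrE ?W0 ?ltr0n// ler_nat.
suff : - W%:R^-1 < x - x' < W%:R^-1 by move=> /andP[h1 h2]; apply/andP; split; lra.
rewrite -(ltr_pM2r W0) mulNr -[X in _ && X](ltr_pM2r W0) mulVf ?gt_eqF// mulrBl.
by apply/andP; split; lra.
Qed.

Lemma truncn_spaced_lt (W : nat) : (0 < W)%N ->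
  all (fun x => (Num.truncn (x * W%:R) < W)%N) xs.
Proof.
move=> W0; apply/allP => x /xs01/andP[x0 x1].
by rewrite truncn_lt_nat ?mulr_ge0// gtr_pMl ?ltr0n.
Qed.

Lemma size_spaced : (0 < P)%N -> (size xs <= P)%N.
Proof.
move=> P0; rewrite -(size_map (fun x => Num.truncn (x * P%:R))) -[leqRHS](size_iota 0 P).
apply: uniq_leq_size.
  by rewrite map_inj_in_uniq//; apply: truncn_spaced_inj; rewrite P0 leqnn.
by move=> k /mapP[x xin ->]; rewrite mem_iota add0n (allP (truncn_spaced_lt P0)).
Qed.

(** Large sieve for spaced points and arbitrary real frequencies: [A] bounds the
    number of frequencies in a cell of length [1/32], and [K] the number of cells.
    With [W = K + P] and [m = 32 W], put [x = (l + s) / W] and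
    [y = (k + r) / 32], with [l], [k] integers and [s], [r] in [0, 1].  Then
    [x y = (l + s) (k + r) / m].  The steps are: [s = r = 0], where Parseval
    modulo [m] applies; general [s], the frequencies [k / m] being at most
    [1/32]; duality; repetition of each cell up to [A] times; general [r], the
    frequencies [x / 32] being at most [1/32]; duality again. *)
Lemma large_sieve (J : eqType) (rJ : seq J) (y : J -> R) (K : nat) (A : R) :
  (0 < P)%N -> 0 < A ->
  {in rJ, forall j, 0 <= y j /\ (Num.truncn (32 * y j) < K)%N} ->
  (forall k, (count (fun j => Num.truncn (32 * y j) == k) rJ)%:R <= A) ->
  mean_square_le rJ xs y id (512 * (K + P)%:R * A).
Proof.
move=> P0 A0 yK yA.
pose W := (K + P)%N; have W0 : (0 < W)%N by rewrite addn_gt0 P0 orbT.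
have WR : 0 < W%:R :> R by rewrite ltr0n.
pose m := (32 * W)%N; have m0 : 0 < m%:R :> R by rewrite ltr0n muln_gt0.
have mE : m%:R = 32 * W%:R :> R by rewrite natrM.
pose k j := Num.truncn (32 * y j).
have step1 : mean_square_le (index_enum 'I_K) xs (fun k : 'I_K => k%:R / m%:R : R)
    (fun x => (Num.truncn (x * W%:R))%:R : R) m%:R.
  move=> b; have Km : (K <= m)%N by [rewrite /m /W; lia].
  rewrite -(fourier_bessel b Km).
  rewrite -[leRHS]mul1r.
  apply: (@sum_fibers_le _ _ _ _ _ _ (fun l => sqnorm (\sum_(k < K) b k * e (k%:R / m%:R * l%:R)))).
  - by move=> l; exact: sqnorm_ge0.
  - by apply: sub_all (truncn_spaced_lt W0) => x /leq_trans; apply; rewrite /m; lia.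
  move=> l; rewrite -[leRHS]/(1%:R) ler_nat.
  rewrite -(count_map (fun x => Num.truncn (x * W%:R)) (pred1 l)) count_uniq_mem; first exact: leq_b1.
  by rewrite map_inj_in_uniq//; apply: truncn_spaced_inj; rewrite P0 leq_addl.
have step2 : mean_square_le (index_enum 'I_K) xs (fun k : 'I_K => k%:R / m%:R : R)
    (fun x => x * W%:R) (4 * m%:R).
  apply: mean_square_perturb step1 _ _ => //.
  - move=> i _; rewrite ger0_norm ?divr_ge0// ler_pdivrMr// mE mul1r mulKf//.
    by rewrite ler_nat ltnW// ltn_addr.
  - move=> x /xs01/andP[x0 _].
    have /andP[h1 h2] : (Num.truncn (x * W%:R))%:R <= x * W%:R < (Num.truncn (x * W%:R)).+1%:R.
      by rewrite truncn_itv// mulr_ge0.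
    by rewrite h1 natr1 ltW.
have step3 := mean_square_dual (mulr_gt0 (ltr0Sn _ 3) m0) step2.
have step4 : mean_square_le xs rJ (fun x => x / 32) (fun j => (k j)%:R) (4 * m%:R * A).
  move=> c; apply: (@le_trans _ _ (A * \sum_(l < K) sqnorm (expsum xs (fun x => x / 32) c l%:R))).
    apply: (@sum_fibers_le _ _ _ _ _ _ (fun l => sqnorm (expsum xs (fun x => x / 32) c l%:R))).
    - by move=> l; exact: sqnorm_ge0.
    - by apply/allP => j /yK[].
    - exact: yA.
  rewrite [4 * _ * A]mulrC -mulrA ler_pM2l//; apply: le_trans (step3 c).
  rewrite le_eqVlt; apply/predU1P; left; apply: eq_bigr => l _; congr (sqnorm _).
  apply: eq_bigr => x _; congr (_ * e _); rewrite mE.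
  by field; rewrite gt_eqF.
have step5 : mean_square_le xs rJ (fun x => x / 32) (fun j => 32 * y j) (16 * m%:R * A).
  have -> : 16 * m%:R * A = 4 * (4 * m%:R * A) by ring.
  apply: mean_square_perturb step4 _ _ => //.
  - by move=> x /xs01/andP[x0 x1]; rewrite ger0_norm ?divr_ge0// ler_pM2r ?invr_gt0// ltW.
  - by rewrite mulr_ge0 ?mulr_ge0// ltW.
  - move=> j /yK[y0 _]; have /andP[h1 h2] : (k j)%:R <= 32 * y j < (k j).+1%:R.
      by rewrite truncn_itv// mulr_ge0.
    by rewrite h1 natr1 ltW.
have D0 : 0 < 16 * m%:R * A by rewrite !mulr_gt0.
move=> b; have := mean_square_dual D0 step5 b.
(* 512 is 4 * 4 * 32: two perturbations, and the modulus m = 32 W. *)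
have -> : 512 * (K + P)%:R * A = 16 * m%:R * A by rewrite mE /W; ring.
apply: le_trans; rewrite le_eqVlt; apply/predU1P; left; apply: eq_bigr => x _.
congr (sqnorm _); apply: eq_bigr => j _; congr (_ * e _).
by field.
Qed.

End Sieve.

(** * The divisor bound *)

(** The number of divisors is submultiplicative: every divisor of [m * n] is a
    divisor of [m], namely its gcd with [m], times a divisor of [n]. *)
Lemma size_divisorsM (m n : nat) : (0 < m)%N -> (0 < n)%N ->
  (size (divisors (m * n)) <= size (divisors m) * size (divisors n))%N.
Proof.
move=> m0 n0; rewrite -(size_allpairs muln).
apply: uniq_leq_size (divisors_uniq _) _ => d; rewrite -dvdn_divisors ?muln_gt0 ?m0// => dmn.
have g0 : (0 < gcdn d m)%N by rewrite gcdn_gt0 m0 orbT.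
have dE : d = (gcdn d m * (d %/ gcdn d m))%N by rewrite mulnC divnK// dvdn_gcdl.
rewrite [X in X \in _]dE; apply: (allpairs_f muln); rewrite -dvdn_divisors//; first exact: dvdn_gcdr.
have mE : m = (gcdn d m * (m %/ gcdn d m))%N by rewrite mulnC divnK// dvdn_gcdr.
rewrite -(@Gauss_dvdr _ (m %/ gcdn d m)); last first.
  by rewrite /coprime -(eqn_pmul2l g0) muln1 muln_gcdr -dE -mE.
by rewrite -(dvdn_pmul2l g0) mulnA -dE -mE.
Qed.

Lemma size_divisors_pfactor (p a : nat) : prime p -> (size (divisors (p ^ a)) <= a.+1)%N.
Proof.
move=> p_pr; rewrite -[leqRHS](size_iota 0) -[leqRHS](size_map (expn p)).
apply: uniq_leq_size (divisors_uniq _) _ => d.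
rewrite -dvdn_divisors ?expn_gt0 ?prime_gt0// => /(dvdn_pfactor _ _ p_pr) [i ia ->].
by apply: map_f; rewrite mem_iota.
Qed.

Section DivisorBound.
Variables (R : realType) (eps : R).
Hypothesis eps_gt0 : 0 < eps.

Let tau n : R := (size (divisors n))%:R.
Let rough y n := forall p, prime p -> (p %| n)%N -> (y <= p)%N.

(** If all prime factors [p] of [n] satisfy [p ^ eps >= 2], then removing one of
    them divides [n ^ eps] by at least 2 and the number of divisors by at most
    2. *)
Lemma divisor_bound_rough (y n : nat) : 2 <= y%:R `^ eps -> (0 < n)%N -> rough y n ->
  tau n <= n%:R `^ eps.
Proof.
move=> y2; elim/ltn_ind: n => n IH n0 ny.
have [n1|n1] := leqP n 1.
  by have -> : n = 1%N by [lia]; rewrite powR1 /tau lexx.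
have p_pr := pdiv_prime n1; set p := pdiv n in p_pr.
have /dvdnP[m nE] : (p %| n)%N by exact: pdiv_dvd.
have p1 := prime_gt1 p_pr.
have m0 : (0 < m)%N by move: n0; rewrite nE muln_gt0 => /andP[].
have mn : (m < n)%N by rewrite nE ltn_Pmulr.
have mrough : rough y m by move=> q q_pr qm; apply: ny; rewrite // nE dvdn_mulr.
have IHm := IH _ mn m0 mrough.
apply: (@le_trans _ _ (tau m * 2)).
  rewrite /tau nE -natrM ler_nat; apply: leq_trans (size_divisorsM m0 (ltnW p1)) _.
  by have := size_divisors_pfactor 1 p_pr; rewrite expn1 leq_mul2l => ->; rewrite orbT.
rewrite nE natrM powRM ?ler0n// ler_pM ?ler0n//; apply: le_trans y2 _.
by rewrite ge0_ler_powR ?nnegrE ?ler0n ?(ltW eps_gt0)// ler_nat ny// /p pdiv_dvd.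
Qed.

(** Choose [y] with [y ^ eps >= 2].  Only the finitely many primes below [y]
    escape the previous lemma.  They are put back one at a time, the largest first;
    the power [p ^ a] costs the factor [a + 1], which by Bernoulli's inequality is
    at most a constant, independent of [a], times [(2 ^ eps) ^ a]. *)
Lemma divisor_bound : exists2 C : R, 1 <= C & forall n, (0 < n)%N -> tau n <= C * n%:R `^ eps.
Proof.
pose y := (Num.truncn (2 `^ eps^-1 : R)).+1.
have y2 : 2 <= y%:R `^ eps :> R.
  rewrite -[leLHS]powRr1// -[X in _ `^ X](mulVf (_ : eps != 0)) ?gt_eqF//.
  by rewrite powRrM ge0_ler_powR ?nnegrE ?powR_ge0 ?ler0n ?(ltW eps_gt0)// ltW// truncnS_gt.
have small i : (i <= y)%N -> exists2 C : R, 1 <= C &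
    forall n, (0 < n)%N -> rough (y - i) n -> tau n <= C * n%:R `^ eps.
  elim: i => [_|i IH iy].
    by exists 1 => // n n0; rewrite subn0 mul1r; exact: divisor_bound_rough.
  have [C C1 HC] := IH (ltnW iy); pose p := (y - i.+1)%N.
  have pE : (y - i)%N = p.+1 by rewrite /p; lia.
  pose u : R := 2 `^ eps - 1.
  have u0 : 0 < u by rewrite subr_gt0 -[ltLHS](congr1 (@^~ eps) (powR1 R)) gt0_ltr_powR ?nnegrE ?ltr1n.
  have u1 : 0 < u^-1 by rewrite invr_gt0.
  exists (C * (1 + u^-1)); first by nra.
  move=> n n0 nr; have [p_pr|p_npr] := boolP (prime p); last first.
    apply: (@le_trans _ _ (C * n%:R `^ eps)).
      apply: HC => // q q_pr qn; rewrite pE ltn_neqAle nr// andbT.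
      by apply: contraNneq p_npr => ->.
    by rewrite ler_wpM2r ?powR_ge0//; nra.
  have [m pm nE] := pfactor_coprime p_pr n0; set a := logn p n in nE.
  have m0 : (0 < m)%N by move: n0; rewrite nE muln_gt0 => /andP[].
  have mr : rough (y - i) m.
    move=> q q_pr qm; rewrite pE ltn_neqAle nr// ?nE ?dvdn_mulr// andbT.
    by apply: contraTneq pm => ->; rewrite prime_coprime// qm.
  have hm := HC _ m0 mr.
  apply: (@le_trans _ _ (tau m * a.+1%:R)).
    rewrite /tau nE -natrM ler_nat; apply: leq_trans (size_divisorsM _ _) _ => //.
      by rewrite expn_gt0 prime_gt0.
    by rewrite leq_mul2l size_divisors_pfactor ?orbT.
  have bern k : k.+1%:R <= (1 + u^-1) * (2 `^ eps) ^+ k :> R.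
    have : 1 + k%:R * u <= (2 `^ eps) ^+ k.
      have -> : 2 `^ eps = 1 + u by rewrite /u; ring.
      elim: k => [|k IHk]; first by rewrite mul0r addr0 expr0.
      rewrite exprS -natr1; have := ler0n R k; nra.
    move=> h; apply: le_trans (ler_wpM2l _ h); last by lra.
    rewrite -natr1; have -> : (1 + u^-1) * (1 + k%:R * u) = 1 + k%:R + u^-1 + k%:R * u.
      by field; rewrite gt_eqF.
    by have := ler0n R k; nra.
  rewrite nE natrM powRM ?ler0n//.
  have -> : C * (1 + u^-1) * (m%:R `^ eps * (p ^ a)%:R `^ eps) =
    C * m%:R `^ eps * ((1 + u^-1) * (p ^ a)%:R `^ eps) by ring.
  rewrite ler_pM// ?ler0n//; apply: le_trans (bern a) _.
  rewrite ler_wpM2l//; first by nra.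
  rewrite -powR_mulrn ?powR_ge0// -!powRrM mulrC powRrM powR_mulrn//.
  rewrite ge0_ler_powR ?nnegrE ?(ltW eps_gt0)// -natrX ler_nat.
  by case: (a) => // k; rewrite leq_exp2r ?prime_gt1.
have [C C1 HC] := small y (leqnn y); exists C => // n n0.
by apply: HC => // p _ _; rewrite subnn.
Qed.
End DivisorBound.

(** * Pairs with a given key, and the expansion of the squared modulus *)

Lemma count_le1 (T : eqType) (a : pred T) (r : seq T) : uniq r ->
  {in r &, forall i j, a i -> a j -> i = j} -> (count a r <= 1)%N.
Proof.
move=> r_uniq aI; rewrite -size_filter.
case E: [seq i <- r | a i] => [|i [|j s]] //; have := seq.filter_uniq a r_uniq.
have hi k : k \in [seq i <- r | a i] -> a k /\ k \in r by rewrite mem_filter => /andP.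
have [] := hi i; first by rewrite E mem_head.
move=> ai ir; have [] := hi j; first by rewrite E !inE eqxx orbT.
by move=> aj jr; rewrite E /= inE (aI i j)// eqxx.
Qed.

Section PairKey.
Variables (M a b : int).
Hypothesis b_gt0 : 0 < b.

(** [b / alpha] times [f n - f m] for [n = M + j.1] and [m = M + j.2], with
    [beta / alpha] replaced by its approximation [a / b]. *)
Definition pair_key (j : nat * nat) : int :=
  (j.1%:Z - j.2%:Z) * (b * ((M + j.1%:Z) + (M + j.2%:Z)) + a).

Lemma pair_keyC k l : pair_key (l, k) = - pair_key (k, l).
Proof. by rewrite /pair_key /=; ring. Qed.

(** The key of [(k, l)] vanishes only if [l = k] or if [l] solves the linear
    equation [b (n + m) + a = 0]. *)
Lemma count_pair_key_eq0 (k : nat) (r : seq nat) : uniq r ->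
  (count (fun l => pair_key (k, l) == 0) r <= 2)%N.
Proof.
move=> r_uniq; pose P l := l == k.
pose Q l := b * ((M + k%:Z) + (M + l%:Z)) + a == 0.
apply: (@leq_trans (count (predU P Q) r)).
  apply: sub_count => l; rewrite /pair_key /= mulf_eq0 => /orP[|h]; last by apply/orP; right.
  by move=> h; apply/orP; left; rewrite /P -eqz_nat eq_sym -subr_eq0.
apply: (@leq_trans (count P r + count Q r)); first by rewrite -count_predUI leq_addr.
apply: (@leq_add _ _ 1 1); apply: count_le1 => // i j _ _.
  by move=> /eqP -> /eqP.
move=> /eqP Ei /eqP Ej.
have : b * (i%:Z - j%:Z) = 0.
  have -> : b * (i%:Z - j%:Z) = (b * ((M + k%:Z) + (M + i%:Z)) + a) -
    (b * ((M + k%:Z) + (M + j%:Z)) + a) by ring.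
  by rewrite Ei Ej.
by move/eqP; rewrite mulf_eq0 gt_eqF//= subr_eq0 => /eqP [].
Qed.

(** A pair is determined by its key [t <> 0] and the difference [d] of its
    entries, since [t / d] gives their sum; and [d] is, up to sign, a divisor of
    [t]. *)
Lemma count_pair_key_eq (t : int) (r : seq (nat * nat)) : t != 0 -> uniq r ->
  (count (fun j => pair_key j == t) r <= 2 * size (divisors `|t|))%N.
Proof.
move=> t0 r_uniq; rewrite -size_filter; set s := seq.filter _ r.
pose g (j : nat * nat) : int := j.1%:Z - j.2%:Z.
pose D := [seq (d%:Z : int) | d <- divisors `|t|].
have -> : (2 * size (divisors `|t|) = size (D ++ map -%R D))%N.
  by rewrite size_cat !size_map addnn mul2n.
rewrite -(size_map g); apply: uniq_leq_size.
  rewrite map_inj_in_uniq ?seq.filter_uniq// => -[k l] [k' l'].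
  rewrite !mem_filter => /andP[/eqP E _] /andP[/eqP E' _] /= gE.
  have E'' := etrans E (esym E'); rewrite /pair_key /= in E E''.
  rewrite /g /= in gE; rewrite -gE in E''.
  have d0 : k%:Z - l%:Z != 0 by apply: contraNneq t0 => d0; rewrite -E d0 mul0r.
  have b0 : b != 0 by rewrite gt_eqF.
  move/(mulfI d0)/addIr/(mulfI b0): E'' => E''.
  by congr (_, _); lia.
move=> z /mapP[[k l]]; rewrite mem_filter => /andP[/eqP E _] ->; rewrite /g /=.
set d : int := k%:Z - l%:Z.
have dt : (`|d| %| `|t|)%N by rewrite -E /pair_key abszM dvdn_mulr.
have dD : (`|d|%N%:Z : int) \in D by apply: map_f; rewrite -dvdn_divisors// absz_gt0.
rewrite mem_cat; case: (ler0P d) => hd; last by rewrite -[d]gtz0_abs// dD.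
by have := map_f -%R dD; rewrite lez0_abs// opprK => ->; rewrite orbT.
Qed.

End PairKey.

Section Degenerate.
Variables (R : realType) (M : int) (a b : int) (b_gt0 : 0 < b).
Variables (r : seq nat) (r_uniq : uniq r).

(** Pairs with key 0 carry no oscillation and are estimated trivially: each index
    occurs in at most two of them on either side, and [w k * w l] is at most the
    mean of the squares. *)
Lemma degenerate_sum_le (w : nat -> R) :
  \sum_(k <- r) \sum_(l <- r | pair_key M a b (k, l) == 0) w k * w l <=
  2 * \sum_(k <- r) w k ^+ 2.
Proof.
have half : \sum_(k <- r) \sum_(l <- r | pair_key M a b (k, l) == 0) w k ^+ 2 <=
    2 * \sum_(k <- r) w k ^+ 2.
  rewrite mulr_sumr; apply: ler_sum => k _.
  rewrite big_const_seq iter_addr_0 -[leLHS]mulr_natl ler_wpM2r ?sqr_ge0// ler_nat.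
  exact: count_pair_key_eq0.
have swap : \sum_(k <- r) \sum_(l <- r | pair_key M a b (k, l) == 0) w l ^+ 2 =
    \sum_(k <- r) \sum_(l <- r | pair_key M a b (k, l) == 0) w k ^+ 2.
  rewrite (exchange_big_dep xpredT)//=; apply: eq_bigr => l _; apply: eq_bigl => k.
  by rewrite pair_keyC oppr_eq0.
have : \sum_(k <- r) \sum_(l <- r | pair_key M a b (k, l) == 0) w k * w l <=
   2^-1 * (\sum_(k <- r) \sum_(l <- r | pair_key M a b (k, l) == 0) w k ^+ 2
   + \sum_(k <- r) \sum_(l <- r | pair_key M a b (k, l) == 0) w l ^+ 2).
  rewrite -big_split mulr_sumr; apply: ler_sum => k _ /=.
  rewrite -big_split mulr_sumr; apply: ler_sum => l _ /=.
  by have := sqr_ge0 (w k - w l); nra.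
by rewrite swap; lra.
Qed.
End Degenerate.

Lemma cabs_sum_le (R : realType) (I : Type) (r : seq I) (P : pred I) (z : I -> R[i]) :
  cabs (\sum_(i <- r | P i) z i) <= \sum_(i <- r | P i) cabs (z i).
Proof.
elim/big_rec2: _ => [|i u v _ IH]; first by rewrite /cabs ComplexField.Normc.normc0.
by apply: le_trans (le_normcD _ _) _; rewrite lerD2l.
Qed.

Section Correlation.
Variables (R : realType) (M : int) (a b : int) (b_gt0 : 0 < b).
Variables (r : seq nat) (r_uniq : uniq r) (f : nat -> R) (c : nat -> R[i]).

Let Z := \sum_(k <- r) sqnorm (c k).
Let rJ := [seq j <- [seq (k, l) | k <- r, l <- r] | pair_key M a b j != 0].

(** Expanding [|S|^2] over pairs and separating the degenerate ones, whose
    contribution is at most [2 Z] in absolute value; 8 is [2 * 2 ^ 2]. *)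
Lemma sqnorm_amplitude_sqr_le (x : R) :
  sqnorm (\sum_(k <- r) c k * e (x * f k)) ^+ 2 <= 8 * Z ^+ 2 +
  2 * sqnorm (expsum rJ (fun j => f j.1 - f j.2) (fun j => c j.1 * conjc (c j.2)) x).
Proof.
set S := \sum_(k <- r) _; set ND := expsum _ _ _ _.
pose term k l := c k * conjc (c l) * e ((f k - f l) * x).
pose Deg := \sum_(k <- r) \sum_(l <- r | pair_key M a b (k, l) == 0) term k l.
have SE : (sqnorm S)%:C = Deg + ND.
  rewrite sqnorm_sumE /Deg /ND /expsum big_filter [X in _ + X]big_mkcond big_allpairs_dep /= -big_split.
  apply: eq_bigr => k _; rewrite -big_mkcond (bigID (fun l => pair_key M a b (k, l) == 0)) /=.
  have tE l : c k * e (x * f k) * conjc (c l * e (x * f l)) = term k l.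
    by rewrite conjM conj_e mulrACA -eD /term; congr (_ * e _); ring.
  by congr (_ + _); apply: eq_bigr => l _; rewrite tE.
have DegZ : cabs Deg <= 2 * Z.
  apply: le_trans (cabs_sum_le _ _ _) _.
  apply: (@le_trans _ _ (\sum_(k <- r) \sum_(l <- r | pair_key M a b (k, l) == 0)
     cabs (c k) * cabs (c l))).
    apply: ler_sum => k _; apply: le_trans (cabs_sum_le _ _ _) _.
    apply: ler_sum => l _; rewrite /term /cabs !ComplexField.Normc.normcM.
    have -> : ComplexField.Normc.normc (conjc (c l)) = ComplexField.Normc.normc (c l).
      by case: (c l) => p q /=; rewrite sqrrN.
    by rewrite /e /= cos2Dsin2 sqrtr1 mulr1.
  apply: le_trans (degenerate_sum_le M a b_gt0 r_uniq _) _.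
  by rewrite ler_wpM2l// /Z; under eq_bigr do rewrite sqr_cabs.
have -> : sqnorm S ^+ 2 = sqnorm (Deg + ND) by rewrite -SE /sqnorm /= expr0n addr0.
apply: le_trans (sqnormD_le _ _) _; rewrite lerD2r -sqr_cabs.
have : 0 <= cabs Deg by rewrite /cabs; case: (Deg) => p q; rewrite sqrtr_ge0.
by move=> h; nra.
Qed.

Lemma sum_correlation_sqnorm_le :
  \sum_(j <- rJ) sqnorm (c j.1 * conjc (c j.2)) <= Z ^+ 2.
Proof.
rewrite big_filter big_mkcond big_allpairs_dep /= expr2 /Z big_distrlr /=.
apply: ler_sum => k _; apply: ler_sum => l _.
rewrite sqnormM sqnormJ; case: ifP => // _.
by rewrite mulr_ge0 ?sqnorm_ge0.
Qed.

End Correlation.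

(** * Spacing of the phase differences *)

Section Fibers.
Variables (R : realType) (M : int) (N : nat) (alpha beta gamma : R) (a b : int).
Hypotheses (N_gt0 : (0 < N)%N) (alpha_gt0 : 0 < alpha) (b_gt0 : 0 < b).
Hypothesis beta_near : `|beta / alpha - a%:~R / b%:~R| < 1 / (4 * b%:~R * N%:R).

Let f (k : nat) : R := quadratic alpha beta gamma (M + k%:Z)%:~R.
Let key := pair_key M a b.
Let rJ := [seq j <- [seq (k, l) | k <- index_iota 1 N.+1, l <- index_iota 1 N.+1] | key j != 0].
(** [Y + 1] is the radicand of [sieve_factor], and [D] the bracket of [PiFactor]
    that carries the exponent [eps]. *)
Let Y : R := alpha * N%:R * (`|M%:~R| + N%:R + `|a%:~R| / b%:~R).
Let D : R := N%:R * b%:~R * (`|M%:~R| + N%:R) + `|a%:~R| + b%:~R / alpha.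

Local Fact N1 : 1 <= N%:R :> R. Proof. by rewrite -[leLHS]/(1%:R) ler_nat. Qed.
Local Fact b1 : 1 <= b%:~R :> R. Proof. by rewrite -[leLHS]/((1%:Z)%:~R) ler_int. Qed.
Local Fact M0 : 0 <= `|M%:~R| :> R. Proof. exact: normr_ge0. Qed.
Local Fact a0 : 0 <= `|a%:~R| :> R. Proof. exact: normr_ge0. Qed.
Local Hint Resolve N1 b1 M0 a0 : core.
Local Fact ba0 : 0 < b%:~R / alpha :> R. Proof. by rewrite divr_gt0// (lt_le_trans ltr01). Qed.
Local Hint Resolve ba0 : core.

Lemma bracket_ge1 : 1 <= D.
Proof.
have h : 1 <= N%:R * b%:~R * (`|M%:~R| + N%:R) :> R.
  by rewrite !mulr_ege1// (le_trans N1)// lerDr.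
by rewrite /D; have := ltW ba0; have := a0; lra.
Qed.

Lemma index_bounds (k : nat) : k \in index_iota 1 N.+1 -> 0 <= (k%:R : R) <= N%:R.
Proof. by rewrite mem_index_iota => /andP[_ kN]; rewrite ler0n ler_nat -ltnS. Qed.

Lemma mem_pairs j : j \in rJ ->
  [/\ key j != 0, 0 <= (j.1%:R : R) <= N%:R & 0 <= (j.2%:R : R) <= N%:R].
Proof.
rewrite mem_filter => /andP[j0 /allpairsP[[k l] [/= kr lr jE]]]; subst j.
by split; [|exact: index_bounds..].
Qed.

(** The bound is the power 2 of [D] because [N |a|] has to be estimated by
    [D * D]; only [D ^ eps] matters in the end. *)
Lemma key_le j : j \in rJ -> `|(key j)%:~R| <= 3 * D ^+ 2 :> R.
Proof.
case/mem_pairs; case: j => k l _ /= /andP[k0 kN] /andP[l0 lN].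
have -> : (key (k, l))%:~R = (k%:R - l%:R) * (b%:~R * (M%:~R + M%:~R + k%:R + l%:R) + a%:~R) :> R.
  by rewrite /key /pair_key /= !(intrM, intrD, rmorphB); ring.
rewrite normrM.
have h1 : `|k%:R - l%:R| <= N%:R :> R by rewrite ler_norml; apply/andP; split; lra.
have h2 : `|b%:~R * (M%:~R + M%:~R + k%:R + l%:R) + a%:~R| <=
    2 * b%:~R * (`|M%:~R| + N%:R) + `|a%:~R| :> R.
  apply: le_trans (ler_normD _ _) _; rewrite lerD2r normrM ger0_norm ?(le_trans ler01)//.
  rewrite -mulrA mulrCA ler_wpM2l ?(le_trans ler01)//.
  have m1 := ler_norm (M%:~R : R); have := ler_norm (- M%:~R : R); rewrite normrN => m2.
  by rewrite ler_norml; apply/andP; split; lra.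
apply: le_trans (ler_pM _ _ h1 h2) _ => //.
have bM : 1 <= b%:~R * (`|M%:~R| + N%:R) :> R.
  by rewrite mulr_ege1// (le_trans N1)// lerDr.
have D1 := bracket_ge1.
have hD : N%:R * (b%:~R * (`|M%:~R| + N%:R)) <= D.
  by rewrite mulrA /D -addrA lerDl addr_ge0 ?(ltW ba0).
have ND : N%:R <= D by apply: le_trans hD; rewrite ler_peMr// (le_trans ler01).
have aD : `|a%:~R| <= D.
  by rewrite /D -addrA addrCA lerDl addr_ge0 ?(ltW ba0)// -mulrA mulr_ge0// (le_trans ler01).
have : N%:R * `|a%:~R| <= D * D by rewrite ler_pM.
by nra.
Qed.

Lemma phase_diffE k l : f k - f l = alpha / b%:~R *
  ((key (k, l))%:~R + b%:~R * (beta / alpha - a%:~R / b%:~R) * (k%:R - l%:R)).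
Proof.
rewrite /f /quadratic /key /pair_key /= !(intrM, intrD, rmorphB) /=.
by field; rewrite !gt_eqF// (lt_le_trans ltr01).
Qed.

(** The approximation hypothesis is exactly what makes the linear error term
    bounded over the whole range of [n - m]. *)
Lemma phase_error (k l : nat) : 0 <= (k%:R : R) <= N%:R -> 0 <= (l%:R : R) <= N%:R ->
  `|b%:~R * (beta / alpha - a%:~R / b%:~R) * (k%:R - l%:R)| <= 1 / 4 :> R.
Proof.
move=> /andP[k0 kN] /andP[l0 lN]; rewrite !normrM (@ger0_norm _ b%:~R) ?(le_trans ler01)//.
have h1 : `|k%:R - l%:R| <= N%:R :> R by rewrite ler_norml; apply/andP; split; lra.
have b0 : 0 < b%:~R :> R by exact: lt_le_trans b1.
have n0 : 0 < N%:R :> R by exact: lt_le_trans N1.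
have h2 : b%:~R * `|beta / alpha - a%:~R / b%:~R| <= 1 / (4 * N%:R).
  rewrite -ler_pdivlMl//; apply: le_trans (ltW beta_near) _.
  by rewrite le_eqVlt; apply/predU1P; left; field; rewrite !gt_eqF.
apply: le_trans (ler_pM _ _ h2 h1) _ => //; first by rewrite mulr_ge0 ?(ltW b0).
by rewrite le_eqVlt; apply/predU1P; left; field; rewrite gt_eqF.
Qed.

Lemma phase_diff_le j : j \in rJ -> `|f j.1 - f j.2| <= 3 * Y.
Proof.
case/mem_pairs; case: j => k l _ /= hk hl.
have b0 : 0 < b%:~R :> R by exact: lt_le_trans b1.
have -> : f k - f l = alpha * ((k%:R - l%:R) *
   ((M%:~R + M%:~R + k%:R + l%:R) + (beta / alpha - a%:~R / b%:~R) + a%:~R / b%:~R)).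
  rewrite /f /quadratic !intrD /=; field; rewrite !gt_eqF//.
rewrite normrM (gtr0_norm alpha_gt0) /Y.
have -> : 3 * (alpha * N%:R * (`|M%:~R| + N%:R + `|a%:~R| / b%:~R)) =
  alpha * (N%:R * (3 * (`|M%:~R| + N%:R + `|a%:~R| / b%:~R))) by ring.
rewrite ler_pM2l// normrM; move: hk hl => /andP[k0 kN] /andP[l0 lN].
apply: ler_pM => //; first by rewrite ler_norml; apply/andP; split; lra.
have m1 := ler_norm (M%:~R : R); have := ler_norm (- M%:~R : R); rewrite normrN => m2.
have ab : `|a%:~R / b%:~R| = `|a%:~R| / b%:~R :> R by rewrite normrM normfV (gtr0_norm b0).
have e1 : `|beta / alpha - a%:~R / b%:~R| <= 1.
  apply: le_trans (ltW beta_near) _; rewrite ler_pdivrMr; last by rewrite !mulr_gt0// (lt_le_trans ltr01).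
  by rewrite mul1r !mulr_ege1// ler1n.
have ab0 : 0 <= `|a%:~R| / b%:~R :> R by rewrite divr_ge0 ?(ltW b0).
move: e1; rewrite ler_norml => /andP[e1 e2].
have : `|a%:~R / b%:~R| <= `|a%:~R| / b%:~R :> R by rewrite ab.
rewrite !ler_norml => /andP[c1 c2].
by have := M0; have := N1; move=> n1 m0; apply/andP; split; lra.
Qed.

Let y j := f j.1 - f j.2 + 3 * Y.

(** Phases in the same cell of length [1/32] differ by less than [1/32], so their
    keys differ by less than [b / (32 alpha) + 1/2], where [1/2] comes from the
    two errors of [1/4]. *)
Lemma keys_close j j' : j \in rJ -> j' \in rJ ->
  Num.truncn (32 * y j) = Num.truncn (32 * y j') ->
  `|(key j - key j')%:~R| < (Num.truncn (b%:~R / alpha : R)).+2%:R :> R.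
Proof.
move=> jr j'r E.
have y0 i : i \in rJ -> 0 <= 32 * y i.
  move=> /phase_diff_le; rewrite ler_norml => /andP[h _].
  by rewrite mulr_ge0// /y; lra.
have := truncn_itv (y0 _ jr); have := truncn_itv (y0 _ j'r); rewrite E -natr1.
move=> /andP[u1 u2] /andP[v1 v2].
have Hb : b%:~R / alpha < (Num.truncn (b%:~R / alpha : R)).+1%:R by exact: truncnS_gt.
rewrite -natr1; move: Hb; set H := _.+1%:R => Hb.
have [_ k1 l1] := mem_pairs jr; have [_ k2 l2] := mem_pairs j'r.
have := phase_error k1 l1; have := phase_error k2 l2.
have : `|y j - y j'| < 1 / 32 by rewrite ltr_norml; apply/andP; split; lra.
have -> : y j - y j' = (f j.1 - f j.2) - (f j'.1 - f j'.2) by rewrite /y; ring.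
rewrite !phase_diffE -!surjective_pairing rmorphB /=.
set t1 := _ * (j'.1%:R - _); set t2 := _ * (j.1%:R - _).
rewrite -mulrBr normrM gtr0_norm; last by rewrite divr_gt0// (lt_le_trans ltr01).
move=> h; have : `|(key j)%:~R + t2 - ((key j')%:~R + t1)| < b%:~R / alpha * (1 / 32).
  by rewrite -ltr_pdivrMl// invf_div.
rewrite ltr_norml => /andP[w1 w2]; rewrite !ler_norml => /andP[x1 x2] /andP[z1 z2].
rewrite ltr_norml; have := ba0 => q; apply/andP; split; lra.
Qed.

(** The keys of the phases in one cell lie among at most
    [2 H + 1 <= 5 (b / alpha + 1)] consecutive integers. *)
Lemma count_phase_le (B : R) (i : nat) : 0 <= B ->
  (forall t, (count (fun j => key j == t) rJ)%:R <= B) ->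
  (count (fun j => Num.truncn (32 * y j) == i) rJ)%:R <= 5 * (b%:~R / alpha + 1) * B.
Proof.
move=> B0 HB; rewrite -size_filter; set s := [seq _ <- _ | _].
have sr j : j \in s -> j \in rJ /\ Num.truncn (32 * y j) = i.
  by rewrite mem_filter => /andP[/eqP -> ->].
case E: s => [|j0 s']; first by rewrite !mulr_ge0// addr_ge0// ltW.
rewrite -E; have [j0r j0i] : j0 \in rJ /\ Num.truncn (32 * y j0) = i.
  by apply: sr; rewrite E mem_head.
pose H := (Num.truncn (b%:~R / alpha : R)).+1.
pose g j := `|(key j - key j0 + H%:Z)%R|%N.
have close j : j \in s -> (`|(key j - key j0)%R| <= H)%N.
  move=> /sr[jr ji]; have := keys_close jr j0r (etrans ji (esym j0i)).
  by rewrite -intr_norm -[_.+2%:R]/((_.+2%:Z)%:~R) ltr_int -abszE ltz_nat ltnS.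
have -> : (size s)%:R = \sum_(j <- s) (1 : R).
  by rewrite big_const_seq count_predT iter_addr_0.
apply: le_trans (@sum_fibers_le R _ s g (2 * H + 1) B (fun=> 1) _ _ _) _ => //.
- by apply/allP => j /close; rewrite /g; lia.
- move=> l; apply: le_trans (HB (key j0 - H%:Z + l%:Z)); rewrite ler_nat.
  rewrite (@eq_in_count _ _ (fun j => key j == key j0 - H%:Z + l%:Z)) => [|j /close].
    by rewrite count_filter sub_count// => j /andP[].
  by rewrite /g; lia.
rewrite mulrC ler_wpM2r//.
rewrite sumr_const card_ord natrD natrM /H -natr1.
have : (Num.truncn (b%:~R / alpha : R))%:R <= b%:~R / alpha by rewrite truncn_le// ltW.
by have := ba0; lra.
Qed.

End Fibers.

(** * Farey fractions and moments *)

Section Farey.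
Variables (R : realType) (Q : nat).

Let xs : seq R := [seq ratr x | x <- finmap.enum_fset (fset_set (farey Q))].

Lemma farey_spaced (x y : rat) : farey Q x -> farey Q y -> x != y ->
  ((Q ^ 2)%N%:R)^-1 <= `|x - y|.
Proof.
move=> [p [q [/andP[q0 qQ] _ _ ->]]] [p' [q' [/andP[q'0 q'Q] _ _ ->]]] ne.
have qR : 0 < q%:R :> rat by rewrite ltr0n.
have q'R : 0 < q'%:R :> rat by rewrite ltr0n.
have E : p%:R / q%:R - p'%:R / q'%:R = ((p * q')%N%:Z - (p' * q)%N%:Z)%:~R / (q * q')%N%:R :> rat.
  by rewrite rmorphB /= !natrM; field; rewrite !gt_eqF.
have num1 : (1 : rat) <= `|((p * q')%N%:Z - (p' * q)%N%:Z)%:~R|.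
  rewrite -intr_norm -[leLHS]/((1%:Z)%:~R) ler_int -gtz0_ge1 normr_gt0.
  by apply: contra_neq ne => E0; apply/eqP; rewrite -subr_eq0 E E0 mul0r.
rewrite E normrM normfV [X in _ / X]ger0_norm//.
rewrite -[leLHS]mul1r ler_pM ?invr_ge0//.
rewrite lef_pV2 ?posrE ?ltr0n ?expn_gt0 ?muln_gt0 ?q0 ?(leq_trans q0 qQ)//.
by rewrite ler_nat leq_mul.
Qed.

Lemma farey_seq_uniq : uniq xs.
Proof. by rewrite map_inj_uniq ?finmap.fset_uniq//; exact: fmorph_inj. Qed.

Lemma mem_farey_seq (x : R) : x \in xs -> exists2 q : rat, farey Q q & x = ratr q.
Proof.
move=> /mapP[q qF ->]; exists q => //.
by move: qF; rewrite in_fset_set; [rewrite inE | exact: finite_farey].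
Qed.

Lemma farey_seq01 : {in xs, forall x : R, 0 <= x < 1}.
Proof.
move=> x /mem_farey_seq[q [u [v [/andP[v0 _] uv _ ->]]] ->].
rewrite fmorph_div /= !ratr_nat divr_ge0//= ltr_pdivrMr ?ltr0n//.
by rewrite mul1r ltr_nat.
Qed.

Lemma farey_seq_spaced :
  {in xs &, forall x x' : R, x != x' -> ((Q ^ 2)%N%:R)^-1 <= `|x - x'|}.
Proof.
move=> x x' /mem_farey_seq[q qF ->] /mem_farey_seq[q' q'F ->] ne.
have qq : q != q' by apply: contraNneq ne => ->.
have := farey_spaced qF q'F qq; rewrite -(ler_rat R) fmorphV /= ratr_nat ratr_norm rmorphB.
by [].
Qed.

Lemma size_farey_seq : (0 < Q)%N -> (size xs)%:R <= Q%:R ^+ 2 :> R.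
Proof.
move=> Q0; rewrite -natrX ler_nat; have Q2 : (0 < Q ^ 2)%N by rewrite expn_gt0 Q0.
exact: size_spaced farey_seq_uniq farey_seq01 farey_seq_spaced Q2.
Qed.

Lemma fsbig_farey (F : R -> R) : \sum_(x \in farey Q) F (ratr x) = \sum_(x <- xs) F x.
Proof. by rewrite fsbig_finite ?big_map//; exact: finite_farey. Qed.

End Farey.

(** [10] is the product of the 5 of [count_phase_le] and the 2 signs of
    [count_pair_key_eq]; [C1] is the constant of the divisor bound, and
    [3 ^ eps] comes from [key_le].  The remaining factor [512 * 512] exceeds
    [2 * 512 * 192 + 8], which is what the large sieve and the expansion of the
    squared modulus contribute. *)
Definition moment_constant (R : realType) (eps C1 : R) : R :=
  512 * 512 * (10 * C1 * 3 `^ eps).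

Section FourthMoment.
Variables (R : realType) (eps C1 : R) (Q : nat) (M : int) (N : nat) (alpha beta gamma : R) (a b : int).
Variable c : int -> R[i].
Hypotheses (eps_gt0 : 0 < eps) (C1_ge1 : 1 <= C1).
Hypothesis tau_le : forall n, (0 < n)%N -> (size (divisors n))%:R <= C1 * n%:R `^ eps.
Hypotheses (Q_gt0 : (0 < Q)%N) (N_gt0 : (0 < N)%N) (alpha_gt0 : 0 < alpha) (b_gt0 : 0 < b).
Hypothesis beta_near : `|beta / alpha - a%:~R / b%:~R| < 1 / (4 * b%:~R * N%:R).

Let Y : R := alpha * N%:R * (`|M%:~R| + N%:R + `|a%:~R| / b%:~R).
Let D : R := N%:R * b%:~R * (`|M%:~R| + N%:R) + `|a%:~R| + b%:~R / alpha.
Let G : R := (b%:~R / alpha + 1) `^ (1 / 2) * D `^ eps.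
Let Z := Zsum M N c.
Let c0 := 10 * C1 * 3 `^ eps.
Let xs : seq R := [seq ratr x | x <- finmap.enum_fset (fset_set (farey Q))].
Let S x := amplitude_sum M N (quadratic alpha beta gamma) c x.

Lemma c0_ge1 : 1 <= c0.
Proof.
rewrite !mulr_ege1 ?ler1n// -[leLHS](congr1 (@^~ eps) (powR1 R)).
by rewrite ge0_ler_powR ?nnegrE ?(ltW eps_gt0)// ler1n.
Qed.

Lemma moment_constant_ge1 : 1 <= moment_constant eps C1.
Proof. by apply: mulr_ege1 c0_ge1; apply: mulr_ege1; rewrite ler1n. Qed.

Lemma sqrG : G ^+ 2 = (b%:~R / alpha + 1) * (D ^+ 2) `^ eps.
Proof.
rewrite exprMn -[X in X * _]powR_mulrn ?powR_ge0// -powRrM.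
rewrite mul1r mulVf ?powRr1//; last by rewrite addr_ge0// divr_ge0 ?ler0z ?ltW.
have D0 : 0 <= D by apply: le_trans ler01 _; exact: bracket_ge1.
by rewrite !expr2 powRM.
Qed.

(** The shift by [3 Y] makes all phase differences nonnegative, as the large
    sieve requires; it multiplies the sum by a number of modulus 1. *)
Lemma fourth_moment_le : \sum_(x <- xs) sqnorm (S x) ^+ 2 <=
  512 * 512 * (Q%:R ^+ 2 + (Y + 1)) * (c0 * G ^+ 2) * Z ^+ 2.
Proof.
pose r := index_iota 1 N.+1; pose cn k := c (M + k%:Z).
pose f (k : nat) : R := quadratic alpha beta gamma (M + k%:Z)%:~R.
pose rJ := [seq j <- [seq (k, l) | k <- r, l <- r] | pair_key M a b j != 0].
pose y j := f j.1 - f j.2 + 3 * Y.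
pose bJ (j : nat * nat) := cn j.1 * conjc (cn j.2).
have D1 : 1 <= D by exact: bracket_ge1.
have ZE : Z = \sum_(k <- r) sqnorm (cn k).
  by apply: eq_bigr => k _; rewrite sqr_cabs.
have r_uniq : uniq r by exact: iota_uniq.
have rJ_uniq : uniq rJ.
  by rewrite seq.filter_uniq// allpairs_uniq// => -[? ?] [? ?].
have Y0 : 0 <= Y.
  rewrite /Y mulr_ge0 ?mulr_ge0 ?addr_ge0 ?divr_ge0 ?ler0z//; exact: ltW.
pose B : R := 2 * (C1 * (3 * D ^+ 2) `^ eps).
have C1_ge0 : 0 <= C1 by exact: le_trans ler01 C1_ge1.
have B0 : 0 <= B by rewrite !mulr_ge0 ?powR_ge0.
have countB t : (count (fun j => pair_key M a b j == t) rJ)%:R <= B.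
  have [/hasP[j jr /eqP jt]|] := boolP (has (fun j => pair_key M a b j == t) rJ); last first.
    by rewrite has_count -eqn0Ngt => /eqP ->.
  have t0 : t != 0 by rewrite -jt; case: (mem_pairs R jr).
  apply: (@le_trans _ _ (2 * (size (divisors `|t|))%:R)).
    by rewrite -natrM ler_nat; exact: count_pair_key_eq.
  rewrite ler_wpM2l//; apply: le_trans (tau_le _) _; first by rewrite absz_gt0.
  rewrite ler_wpM2l// ge0_ler_powR ?nnegrE ?(ltW eps_gt0)//.
    by rewrite mulr_ge0// sqr_ge0.
  have := key_le N_gt0 alpha_gt0 b_gt0 jr; rewrite jt.
  by rewrite -intr_norm -abszE.
pose A : R := c0 * G ^+ 2.
have AE : A = 5 * (b%:~R / alpha + 1) * B.
  by rewrite /A /c0 sqrG /B powRM ?sqr_ge0//; ring.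
have A1 : 1 <= A.
  rewrite /A mulr_ege1 ?c0_ge1//.
  rewrite sqrG mulr_ege1//; first by rewrite lerDr divr_ge0 ?ler0z ?ltW.
  rewrite -[leLHS](congr1 (@^~ eps) (powR1 R)) ge0_ler_powR ?nnegrE ?(ltW eps_gt0) ?sqr_ge0//.
  by rewrite expr_ge1// (le_trans ler01).
have A0 : 0 < A by exact: lt_le_trans ltr01 A1.
have Q2 : (0 < Q ^ 2)%N by rewrite expn_gt0 Q_gt0.
(* The shifted differences y lie in [0, 6 Y], and 192 = 32 * 6. *)
have [K KY yK] : exists2 K : nat, K%:R <= 192 * Y + 1 &
    {in rJ, forall j, 0 <= y j /\ (Num.truncn (32 * y j) < K)%N}.
  exists (Num.truncn (192 * Y)).+1.
    by rewrite -natr1 lerD2r truncn_le mulr_ge0.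
  move=> j jr; have := phase_diff_le gamma N_gt0 alpha_gt0 b_gt0 beta_near jr.
  rewrite ler_norml -/(f j.1) -/(f j.2) -/Y => /andP[h1 h2].
  have y0 : 0 <= y j by rewrite /y; lra.
  split => //; rewrite truncn_lt_nat ?mulr_ge0//.
  apply: le_lt_trans (truncnS_gt _); rewrite /y; lra.
have yA k : (count (fun j => Num.truncn (32 * y j) == k) rJ)%:R <= A.
  rewrite AE; exact: count_phase_le.
have LS := large_sieve (farey_seq_uniq R Q) (@farey_seq01 R Q) (@farey_seq_spaced R Q) Q2 A0 yK yA.
have sizeQ := size_farey_seq R Q_gt0.
pose T x := expsum rJ (fun j => f j.1 - f j.2) bJ x.
have SE x : sqnorm (S x) ^+ 2 <= 8 * Z ^+ 2 + 2 * sqnorm (T x).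
  by rewrite ZE; exact: (sqnorm_amplitude_sqr_le M a b_gt0 r_uniq f cn x).
have TE x : sqnorm (T x) = sqnorm (expsum rJ y bJ x).
  have -> : expsum rJ y bJ x = e (3 * Y * x) * T x.
    rewrite /expsum mulr_sumr; apply: eq_bigr => j _.
    by rewrite /y mulrDl eD mulrA mulrC.
  by rewrite sqnormM sqnorm_e mul1r.
have bZ : \sum_(j <- rJ) sqnorm (bJ j) <= Z ^+ 2.
  by rewrite ZE; exact: sum_correlation_sqnorm_le.
have Z0 : 0 <= Z ^+ 2 by exact: sqr_ge0.
have Tsum : \sum_(x <- xs) sqnorm (T x) <= 512 * (K + Q ^ 2)%:R * A * Z ^+ 2.
  under eq_bigr do rewrite TE.
  apply: (le_trans (LS bJ)).
  apply: ler_wpM2l bZ.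
  apply: mulr_ge0 (ltW A0).
  by apply: mulr_ge0; exact: ler0n.
apply: (@le_trans _ _ (8 * Z ^+ 2 * (size xs)%:R + 2 * \sum_(x <- xs) sqnorm (T x))).
  apply: (@le_trans _ _ (\sum_(x <- xs) (8 * Z ^+ 2 + 2 * sqnorm (T x)))).
    by apply: ler_sum => x _; exact: SE.
  by rewrite [2 * \sum_(x <- _) _]mulr_sumr big_split /= big_const_seq count_predT iter_addr_0 mulr_natr.
rewrite natrD natrX in Tsum; rewrite -/A; move: (Z ^+ 2) Z0 Tsum => Z2 Z0 Tsum.
have h1 : 8 * Z2 * (size xs)%:R <= 8 * Z2 * (A * Q%:R ^+ 2).
  rewrite ler_wpM2l ?mulr_ge0//; apply: le_trans sizeQ _.
  by rewrite ler_peMl ?sqr_ge0.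
have h2 : 512 * (K%:R + Q%:R ^+ 2) * A * Z2 <= 512 * (192 * Y + 1 + Q%:R ^+ 2) * A * Z2.
  apply: (ler_wpM2r Z0); apply: (ler_wpM2r (ltW A0)); apply: ler_wpM2l; first exact: ler0n.
  by rewrite lerD2r.
have h5 : 0 <= A * Z2 := mulr_ge0 (ltW A0) Z0.
have h3 : 0 <= A * Z2 * Q%:R ^+ 2 := mulr_ge0 h5 (sqr_ge0 _).
have h6 : 0 <= A * Z2 * Y := mulr_ge0 h5 Y0.
lra.
Qed.

(** Cauchy-Schwarz over the Farey fractions, then
    [Q^2 (Q^2 + (Y + 1)) <= (Q^2 + Q sqrt (Y + 1))^2]. *)
Lemma second_moment_le : \sum_(x <- xs) sqnorm (S x) <=
  moment_constant eps C1 * (Q%:R ^+ 2 + Q%:R * Num.sqrt (Y + 1)) * G * Z.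
Proof.
have Y0 : 0 <= Y + 1.
  rewrite /Y addr_ge0 ?mulr_ge0 ?addr_ge0 ?divr_ge0 ?ler0z//; exact: ltW.
have Z0 : 0 <= Z by apply: sumr_ge0 => k _; exact: sqr_ge0.
have G0 : 0 <= G by rewrite mulr_ge0 ?powR_ge0.
have := fourth_moment_le; set kappa := moment_constant eps C1.
have k1 : 1 <= kappa := moment_constant_ge1.
have -> : 512 * 512 * (Q%:R ^+ 2 + (Y + 1)) * (c0 * G ^+ 2) * Z ^+ 2 =
  kappa * ((Q%:R ^+ 2 + (Y + 1)) * (G * Z) ^+ 2) by rewrite /kappa /moment_constant -/c0; ring.
move: kappa k1 => kappa k1 h4; set s := Num.sqrt (Y + 1).
have s0 : 0 <= s by exact: sqrtr_ge0.
have sE : Y + 1 = s ^+ 2 by rewrite sqr_sqrtr.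
have q0 : 0 <= Q%:R :> R by exact: ler0n.
have GZ0 : 0 <= G * Z := mulr_ge0 G0 Z0.
rewrite -mulrA; move: (G * Z) GZ0 h4 => g g0 h4.
have qs0 : 0 <= Q%:R ^+ 2 + Q%:R * s := addr_ge0 (sqr_ge0 _) (mulr_ge0 q0 s0).
have V0 : 0 <= \sum_(x <- xs) sqnorm (S x) by apply: sumr_ge0 => x _; exact: sqnorm_ge0.
have k0 : 0 <= kappa := le_trans ler01 k1.
rewrite -ler_sqr ?nnegrE ?mulr_ge0//; apply: le_trans (sqr_sum_le _ _) _.
apply: (@le_trans _ _ (Q%:R ^+ 2 * (kappa * ((Q%:R ^+ 2 + (Y + 1)) * g ^+ 2)))).
  apply: ler_pM h4 => //; first by apply: sumr_ge0 => x _; exact: sqr_ge0.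
  exact: size_farey_seq.
rewrite sE [leRHS](_ : _ = Q%:R ^+ 2 * (kappa * (kappa * (Q%:R + s) ^+ 2 * g ^+ 2))); last by ring.
apply: ler_wpM2l (sqr_ge0 _) _ _ _; apply: (ler_wpM2l k0).
apply: (ler_wpM2r (sqr_ge0 _)).
apply: (@le_trans _ _ ((Q%:R + s) ^+ 2)); last by rewrite ler_peMl ?sqr_ge0.
by rewrite sqrrD -addrA [_ *+ 2 + _]addrC addrA lerDl mulrn_wge0// mulr_ge0.
Qed.

End FourthMoment.

Unset Implicit Arguments.

Theorem theorem3 (R : realType) (eps : R) (eps_gt0 : 0 < eps) :
  exists C : R, 0 < C /\
  forall (Q : nat) (M : int) (N : nat) (alpha beta gamma : R) (a b : int)
         (c : int -> R[i]),
    (1 <= Q)%N -> (0 < N)%N -> 0 < alpha ->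
    0 < b -> coprimez a b ->
    `|beta / alpha - a%:~R / b%:~R| < 1 / (4 * b%:~R * N%:R) ->
    \sum_(x \in farey Q)
       cabs (amplitude_sum M N (quadratic alpha beta gamma) c (ratr x)) ^+ 2
    <= C * sieve_factor Q alpha M N a b * PiFactor eps alpha M N a b
         * Zsum M N c.
Proof.
have [C1 C1_ge1 tau_le] := divisor_bound eps_gt0.
have C0 : 0 < moment_constant eps C1.
  exact: lt_le_trans ltr01 (moment_constant_ge1 eps_gt0 C1_ge1).
exists (moment_constant eps C1); split => //.
move=> Q M N alpha beta gamma a b c Q0 N0 alpha0 b0 _ near.
rewrite (fsbig_farey Q (fun x => cabs (amplitude_sum M N (quadratic alpha beta gamma) c x) ^+ 2)).
under eq_bigr do rewrite sqr_cabs.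
have H := second_moment_le M gamma c eps_gt0 C1_ge1 tau_le Q0 N0 alpha0 b0 near.
apply: (le_trans H).
have Z0 : 0 <= Zsum M N c by apply: sumr_ge0 => k _; exact: sqr_ge0.
apply: (ler_wpM2r Z0); rewrite /sieve_factor; apply: ler_wpM2l.
  apply: mulr_ge0 (ltW C0) _; apply: addr_ge0 (sqr_ge0 _) _.
  exact: mulr_ge0 (ler0n _ _) (sqrtr_ge0 _).
rewrite /PiFactor; apply: (ler_wpM2r (powR_ge0 _ _)).
rewrite ler_powR ?lerDl ?(ltW eps_gt0)// lerDr divr_ge0 ?ler0z ?(ltW alpha0)//.
exact: ltW.
Qed.
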